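(* Let $n \ge 2$ and let $X_1,\dots,X_n,\Lambda,\Lambda'$ be jointly distributed random variables. (Exact form) Suppose that $X_1,\dots,X_n$ are independent given $\Lambda$, and that for every $j\in\{1,\dots,n\}$ the variable $\Lambda'$ is determined by $X_j$, i.e. $H(\Lambda'\mid X_j)=0$. Then $\Lambda'$ is determined by $\Lambda$, i.e. $H(\Lambda'\mid\Lambda)=0$. (Approximate form) More generally, let $\epsilon_{med},\epsilon_{red}\ge 0$ and suppose that $$D_{KL}\Big(P[\Lambda,X_1,\dots,X_n]\,\Big\|\,P[\Lambda]\prod_{j=1}^n P[X_j\mid\Lambda]\Big)\le\epsilon_{med}$$ and $H(\Lambda'\mid X_j)\le\epsilon_{red}$ for every $j\in\{1,\dots,n\}$. Then $$H(\Lambda'\mid\Lambda)\le\epsilon_{med}+2\epsilon_{red}.$$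
   Context: All random variables are defined on a common probability space. The variables $X_1,\dots,X_n$ and $\Lambda'$ are discrete (countable-valued); $\Lambda$ takes values in a standard Borel space (in particular it may be discrete). $P[\cdot]$ denotes (joint, marginal or conditional) distributions, $D_{KL}$ is the Kullback–Leibler divergence, and $H(\cdot\mid\cdot)$ is conditional Shannon entropy, all with logarithms to the same fixed base. $P[\Lambda]\prod_j P[X_j\mid\Lambda]$ is the joint law of $(\Lambda,X_1,\dots,X_n)$ in which $\Lambda$ has its true marginal law and, given $\Lambda$, the $X_j$ are independent with their true conditional laws given $\Lambda$. For a discrete variable $Y$, ''$Y$ is determined by $Z$'' means $Y$ is almost surely a function of $Z$, equivalently $H(Y\mid Z)=0$. *)

(* Defs.v *)
From HB Require Import structures.
From mathcomp Require Import all_boot all_order all_algebra.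
From mathcomp Require Import all_classical all_reals all_analysis.
From mathcomp Require Import measurable_realfun.

Set Implicit Arguments.
Unset Strict Implicit.
Unset Printing Implicit Defensive.

Import Order.TTheory GRing.Theory Num.Theory.
Import numFieldNormedType.Exports.

Local Open Scope classical_set_scope.
Local Open Scope ring_scope.

(* Pointedness is there only because measurable types must be pointed. *)
#[short(type="alphabetType")]
HB.structure Definition Alphabet := {S of Countable S & Pointed S}.

HB.instance Definition _ := Countable.on nat.
HB.instance Definition _ := Countable.on bool.

HB.instance Definition _ (n : nat) (S : 'I_n -> alphabetType) :=
  isPointed.Build {dffun forall j : 'I_n, S j} [ffun j => point].

Definition discrete (S : alphabetType) : Type := S.

HB.instance Definition _ (S : alphabetType) := Alphabet.on (discrete S).
HB.instance Definition _ (S : alphabetType) :=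
  @isMeasurable.Build default_measure_display (discrete S)
    discrete_measurable discrete_measurable0
    discrete_measurableC discrete_measurableU.

#[short(type=completeMetricType)]
HB.structure Definition CompleteMetric (R : numDomainType) :=
  {M of Metric R M & CompletePseudoMetric R M}.

(* Being the Borel space of a Polish space, up to measurable isomorphism. *)
Definition standard_borel (R : realType) (d : measure_display)
    (L : measurableType d) : Prop :=
  exists (M : completeMetricType R) (f : L -> M),
    [/\ exists2 D : set M, countable D & dense D,
        bijective f &
        forall A : set L,
          measurable A <-> exists2 B, <<s [set U : set M | open U] >> B &
                                      A = f @^-1` B].

Section joint.
Context (d dL : measure_display) (T : measurableType d) (L : measurableType dL).
Context (n : nat) (S : 'I_n -> alphabetType).
Context (X : forall j : 'I_n, {mfun T >-> discrete (S j)}).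

Definition tuple_rv (w : T) : discrete {dffun forall j : 'I_n, S j} :=
  [ffun j => X j w].

Let measurable_tuple_rv : measurable_fun [set: T] tuple_rv.
Proof.
move=> _ A _; rewrite setTI.
have -> : tuple_rv @^-1` A = \bigcup_(x in A) (tuple_rv @^-1` [set x]).
  apply/seteqP; split=> [w Aw|w [x Ax /= ->//]].
  by exists (tuple_rv w).
rewrite bigcup_mkcond; apply: countable_bigcupT_measurable => [|x].
  exact: countableP.
case: ifPn => // _.
have -> : tuple_rv @^-1` [set x] =
    \bigcap_(j in [set: 'I_n]) (X j @^-1` [set x j]).
  apply/seteqP; split => [w /= <- j _ /=|w Xw]; first by rewrite ffunE.
  by apply/ffunP => j; rewrite ffunE; exact: Xw.
apply: fin_bigcap_measurable => [|j _]; first exact: finite_finset.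
by rewrite -[X in measurable X]setTI; exact: measurable_funPT.
Qed.

HB.instance Definition _ :=
  isMeasurableFun.Build _ _ _ _ tuple_rv measurable_tuple_rv.

Context (Z : {mfun T >-> L}).

Definition joint_rv (w : T) : L * discrete {dffun forall j : 'I_n, S j} :=
  (Z w, tuple_rv w).

Let measurable_joint_rv : measurable_fun [set: T] joint_rv.
Proof. by apply: measurable_fun_pair; exact: measurable_funPT. Qed.

HB.instance Definition _ :=
  isMeasurableFun.Build _ _ _ _ joint_rv measurable_joint_rv.

End joint.

Section cond_prob.
Context (R : realType) (b : R) (d dL : measure_display).
Context (T : measurableType d) (L : measurableType dL) (P : probability T R).
Context (S : alphabetType) (Y : {mfun T >-> discrete S}) (Z : {mfun T >-> L}).
Local Open Scope ereal_scope.

Definition event_law (A : set S) (B : set L) : \bar R :=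
  P (Y @^-1` A `&` Z @^-1` B).

Section instances.
Variable A : set S.

Let mY : measurable (Y @^-1` A).
Proof. by rewrite -[X in measurable X]setTI; exact: measurable_funPT. Qed.

Let mZ B : measurable B -> measurable (Z @^-1` B).
Proof.
by move=> mB; rewrite -[X in measurable X]setTI; exact: measurable_funPT.
Qed.

Let event_law0 : event_law A set0 = 0.
Proof. by rewrite /event_law preimage_set0 setI0 measure0. Qed.

Let event_law_ge0 B : 0 <= event_law A B.
Proof. exact: measure_ge0. Qed.

Let event_law_sigma_additive : semi_sigma_additive (event_law A).
Proof.
move=> F mF tF mUF; rewrite /event_law preimage_bigcup setI_bigcupr.
apply: measure_semi_sigma_additive.
- by move=> i; apply: measurableI => //; exact: mZ.
- apply/trivIsetP => i j _ _ ij; rewrite setIACA -(preimage_setI Z).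
  by move/trivIsetP : tF => /(_ _ _ I I ij) ->; rewrite preimage_set0 setI0.
- rewrite -setI_bigcupr -preimage_bigcup.
  by apply: measurableI => //; exact: mZ.
Qed.

HB.instance Definition _ := isMeasure.Build _ _ _ (event_law A)
  event_law0 event_law_ge0 event_law_sigma_additive.

Let event_law_fin : fin_num_fun (event_law A).
Proof. by move=> B mB; apply: fin_num_measure; apply: measurableI => //; exact: mZ. Qed.

HB.instance Definition _ := Measure_isFinite.Build _ _ _ (event_law A)
  event_law_fin.

End instances.

(* A version of P(Y \in A | Z = z): the Radon-Nikodym derivative of
   B |-> P(Y \in A, Z \in B) with respect to the law of Z. The derivative is in
   [0, 1] only almost everywhere; the minimum makes it so everywhere. *)
Definition cond_prob (A : set S) (z : L) : R :=
  Num.min 1%R (fine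
    (Radon_Nikodym_SigmaFinite.f (event_law A) (distribution P Z) z)).

Definition cond_pmf (y : S) (z : L) : R := cond_prob [set y] z.

Lemma event_law_dominates (A : set S) :
  (event_law A : set L -> \bar R) `<< distribution P Z.
Proof.
apply/null_content_dominatesP => B mB PB0; apply/eqP; rewrite eq_le measure_ge0 andbT.
rewrite -PB0; apply: le_measure; rewrite ?inE.
- apply: measurableI; rewrite -[X in measurable X]setTI; exact: measurable_funPT.
- by rewrite -[X in measurable X]setTI; exact: measurable_funPT.
- exact: subIsetr.
Qed.

Lemma cond_prob_ge0 (A : set S) (z : L) : (0 <= cond_prob A z)%R.
Proof.
rewrite /cond_prob le_min ler01 fine_ge0//.
exact/Radon_Nikodym_SigmaFinite.f_ge0/event_law_dominates.
Qed.

Lemma cond_prob_le1 (A : set S) (z : L) : (cond_prob A z <= 1)%R.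
Proof. by rewrite /cond_prob ge_min lexx. Qed.

Lemma measurable_cond_prob (A : set S) : measurable_fun [set: L] (cond_prob A).
Proof.
apply: measurable_minr => //; apply: measurableT_comp => //.
apply: (measurable_int (distribution P Z)).
exact/Radon_Nikodym_SigmaFinite.f_integrable/event_law_dominates.
Qed.

Definition determined_by : Prop :=
  exists f : L -> discrete S,
    measurable_fun [set: L] f /\ {ae P, forall w, Y w = f (Z w)}.

(* H(Y | Z) = \int H(P[Y | Z = z]) P_Z(dz), logarithms to base b *)
Definition cond_entropy : \bar R :=
  \int[distribution P Z]_z
    \esum_(y in [set: S]) (- (cond_pmf y z * (ln (cond_pmf y z) / ln b)))%:E.

End cond_prob.

Section cond_indep.
Context (R : realType) (d dL : measure_display).
Context (T : measurableType d) (L : measurableType dL) (P : probability T R).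
Context (n : nat) (S : 'I_n -> alphabetType).
Context (X : forall j : 'I_n, {mfun T >-> discrete (S j)}).
Context (Z : {mfun T >-> L}).
Local Open Scope ereal_scope.

Definition cond_independent : Prop :=
  forall A : forall j : 'I_n, set (S j),
    {ae distribution P Z, forall z,
      cond_prob P (tuple_rv X) Z [set x | forall j, A j (x j)] z =
      (\prod_(j < n) cond_prob P (X j) Z (A j) z)%R}.

Definition prod_pmf (x : {dffun forall j : 'I_n, S j}) (z : L) : R :=
  (\prod_(j < n) cond_pmf P (X j) Z (x j) z)%R.

(* The law P[Z] \prod_j P[X_j | Z]: draw z from the law of Z, then the
   coordinates x_j independently from P[X_j | Z = z]. *)
Definition cond_product_law
    (B : set (L * discrete {dffun forall j : 'I_n, S j})) : \bar R :=
  \esum_(x in [set: {dffun forall j : 'I_n, S j}])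
    \int[distribution P Z]_(z in [set z | B (z, x)]) (prod_pmf x z)%:E.

Lemma prod_pmf_ge0 x z : (0 <= prod_pmf x z)%R.
Proof. by apply: prodr_ge0 => j _; exact: cond_prob_ge0. Qed.

Lemma prod_pmf_le1 x z : (prod_pmf x z <= 1)%R.
Proof.
by apply: prodr_ile1 => j _; rewrite cond_prob_ge0 cond_prob_le1.
Qed.

Lemma measurable_prod_pmf x : measurable_fun [set: L] (prod_pmf x).
Proof. by apply: measurable_prod => j _; exact: measurable_cond_prob. Qed.

Let msection (B : set (L * discrete {dffun forall j : 'I_n, S j})) x :
  measurable B -> measurable [set z | B (z, x)].
Proof.
move=> mB; have := measurable_ysection x mB.
by congr measurable; apply/seteqP; split => z; rewrite /ysection/= inE.
Qed.

Let int_ge0 B x :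
  0 <= \int[distribution P Z]_(z in [set z | B (z, x)]) (prod_pmf x z)%:E.
Proof. by apply: integral_ge0 => z _; rewrite lee_fin prod_pmf_ge0. Qed.

Let law0 : cond_product_law set0 = 0.
Proof.
by rewrite /cond_product_law; apply: esum1 => x _; exact: integral_set0.
Qed.

Let law_ge0 B : 0 <= cond_product_law B.
Proof. by apply: esum_ge0 => x _; exact: int_ge0. Qed.

Let law_sigma_additive : semi_sigma_additive cond_product_law.
Proof.
move=> F mF tF mUF.
have -> : cond_product_law (\bigcup_k F k) =
    \sum_(0 <= k <oo) cond_product_law (F k).
  rewrite nneseries_esumT// /cond_product_law [RHS]esum_esum//=.
  under eq_esum => x _.
    have -> : [set z | (\bigcup_k F k) (z, x)] =
      \bigcup_k [set z | F k (z, x)] by [].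
    rewrite ge0_integral_bigcup/=; last 4 first.
    - by move=> k; exact: msection.
    - apply: measurable_funTS; apply/measurable_EFinP.
      exact: measurable_prod_pmf.
    - by move=> z _; rewrite lee_fin prod_pmf_ge0.
    - apply/trivIsetP => i j _ _ ij; apply/seteqP; split => // z [Fi Fj].
      by move/trivIsetP : tF => /(_ i j I I ij); apply/eqP/set0P; exists (z, x).
    rewrite nneseries_esumT//.
    over.
  rewrite esum_esum//=.
  rewrite (reindex_esum ([set: nat] `*`` (fun=> setT)) _
    (fun x => (x.2, x.1)))//; split=> //=.
  - by move=> [i1 i2] [j1 j2] /= _ _ [] -> ->.
  - by move=> [i1 i2] _ /=; exists (i2, i1).
by apply: is_cvg_nneseries => k _ _.
Qed.

HB.instance Definition _ := isMeasure.Build _ _ _ cond_product_law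
  law0 law_ge0 law_sigma_additive.

Let law_sigma_finite : sigma_finite [set: _] cond_product_law.
Proof.
pose D := {dffun forall j : 'I_n, S j}.
exists (fun k => [set p | pickle (p.2 : D) = k]).
  by apply/seteqP; split => // p _; exists (pickle (p.2 : D)).
move=> k; split.
  rewrite (_ : [set p | _] = snd @^-1` [set x : discrete D | pickle (x : D) = k])//.
  by rewrite -[X in measurable X]setTI; exact: measurable_snd.
have [[x xk]|nk] := pselect (exists x : D, pickle x = k); last first.
  rewrite /cond_product_law esum1// => x _.
  rewrite [X in \int[_]_(_ in X) _](_ : _ = set0) ?integral_set0//.
  by apply/seteqP; split => // z /= xk; apply: nk; exists x.
rewrite (_ : cond_product_law _ =
    \esum_(y in [set x]) \int[distribution P Z]_z (prod_pmf y z)%:E); last first.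
  rewrite [RHS]esum_mkcond; apply: eq_esum => y _; case: ifPn => /=.
    rewrite inE /= => ->; congr integral.
    by apply/seteqP; split.
  rewrite notin_setE /= => yx.
  rewrite [X in \int[_]_(_ in X) _](_ : _ = set0) ?integral_set0//.
  apply/seteqP; split => // z /= yk; apply: yx.
  by apply: (pcan_inj (@pickleK D)); rewrite xk.
rewrite esum_set1; last first.
  by apply: integral_ge0 => z _; rewrite lee_fin prod_pmf_ge0.
apply: (@le_lt_trans _ _ (\int[distribution P Z]_z (cst 1 z))).
  apply: ge0_le_integral => //.
  - by move=> z _; rewrite lee_fin prod_pmf_ge0.
  - by apply/measurable_EFinP; exact: measurable_prod_pmf.
  - by move=> z _; rewrite lee_fin prod_pmf_le1.
rewrite integral_cst// mul1e.
exact: (le_lt_trans (probability_le1 _ measurableT) (ltry _)).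
Qed.

HB.instance Definition _ := Measure_isSigmaFinite.Build _ _ _ cond_product_law
  law_sigma_finite.

End cond_indep.

(* The derivative of [mu] with respect to [nu] vanishes only on a [mu]-null set,
   so that the convention [ln 0 = 0] is immaterial. When [nu] is finite the
   negative part of the integrand is integrable, hence the integral is well
   defined in ]-oo, +oo]. *)
Definition KL (R : realType) (b : R) (d : measure_display)
    (T : measurableType d) (mu : {finite_measure set T -> \bar R})
    (nu : {sigma_finite_measure set T -> \bar R}) : \bar R :=
  if `[< mu `<< nu >] then
    (\int[mu]_x (ln (fine (Radon_Nikodym_SigmaFinite.f mu nu x)) / ln b)%:E)%E
  else +oo%E.

(* Main.v *)
(* Write Z, Y for Lambda, Lambda', let f be the density of the joint law of
   (Z, X_1, ..., X_n) with respect to P[Z] \prod_j P[X_j | Z], and fix two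
   distinct indices, called 1 and 2. Put q_i = P(Y | X_i), r_i = P(X_i | Z),
   a_i = P(X_i, Y | Z), all evaluated at the random variables themselves, and
     t_i = q_i r_i / a_i (i = 1, 2),  t_3 = a_1 a_2 / (r_1 r_2 f P(Y | Z)).
   Then f P(Y | Z) t_1 t_2 t_3 = q_1 q_2 almost surely, and each t_i has mean at
   most 1: for t_3 this uses P(X, Y | Z) <= P(X | Z) = f \prod_j P(X_j | Z).
   Taking logarithms, bounding ln t_i by t_i - 1 and integrating gives
   H(Y | Z) <= E[log f] + H(Y | X_1) + H(Y | X_2). Conditional independence is
   the case f = 1. *)
Require Import Defs.
From HB Require Import structures.
From mathcomp Require Import all_boot all_order all_algebra.
From mathcomp Require Import all_classical all_reals all_analysis.
From mathcomp Require Import measurable_realfun ring lra.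

Set Implicit Arguments.
Unset Strict Implicit.
Unset Printing Implicit Defensive.

Import Order.TTheory GRing.Theory Num.Theory.
Import numFieldNormedType.Exports.

Local Open Scope classical_set_scope.
Local Open Scope ring_scope.

(** * Sums over countable types and their exchange with integrals *)

Section countable_sums.
Context (R : realType) (I : countType).
Local Open Scope ereal_scope.

(** Enumerating [I] by its encoding, with 0 at numbers that encode nothing, makes the results on
    series indexed by [nat] available for any countable type. *)
Lemma esum_pickle (a : I -> \bar R) : (forall i, 0 <= a i) ->
  \esum_(i in [set: I]) a i = \sum_(k <oo) oapp a 0 (pickle_inv k).
Proof.
move=> a0; have b0 k : 0 <= oapp a 0 (pickle_inv (T:=I) k).
  by case: pickle_inv => //=.
rewrite nneseries_esumT//; transitivity (\esum_(k in range (@pickle I))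
    oapp a 0 (pickle_inv (T:=I) k)).
  rewrite esum_image; last by apply: in2W; exact: (pcan_inj pickleK).
  by apply: eq_esum => i _; rewrite pickleK_inv.
rewrite esum_mkcond; apply: eq_esum => k _; case: ifPn => // kI.
move: (pickle_invK (T:=I) k); case: pickle_inv => //= i ik.
by move: kI; rewrite notin_setE; case; exists i.
Qed.

Lemma ge0_esumZl (k : R) (a : I -> \bar R) : (0 <= k)%R ->
  (forall i, 0 <= a i) ->
  \esum_(i in [set: I]) (k%:E * a i) = k%:E * \esum_(i in [set: I]) a i.
Proof.
move=> k0 a0; rewrite !esum_pickle//; last first.
  by move=> i; rewrite mule_ge0// lee_fin.
rewrite -nneseriesZl; last by move=> i _; case: pickle_inv => /=.
by apply: eq_eseriesr => i _; case: pickle_inv => //=; rewrite mule0.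
Qed.

Context (d : measure_display) (T : measurableType d).
Context (mu : {measure set T -> \bar R}) (f : I -> T -> \bar R).
Hypotheses (f0 : forall i x, 0 <= f i x)
           (mf : forall i, measurable_fun [set: T] (f i)).

Let seriesE : (fun x => \esum_(i in [set: I]) f i x) =
  (fun x => \sum_(k <oo) oapp (f^~ x) 0 (pickle_inv k)).
Proof. by apply/funext => x; rewrite esum_pickle. Qed.

Let term_ge0 k x : 0 <= oapp (f^~ x) 0 (pickle_inv (T:=I) k).
Proof. by case: pickle_inv => /=. Qed.

Let measurable_term k :
  measurable_fun [set: T] (fun x => oapp (f^~ x) 0 (pickle_inv (T:=I) k)).
Proof. by case: pickle_inv => //=. Qed.

Lemma measurable_esum :
  measurable_fun [set: T] (fun x => \esum_(i in [set: I]) f i x).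
Proof. by rewrite seriesE; exact: ge0_emeasurable_sum. Qed.

(** After the enumeration this is monotone convergence for a series of nonnegative functions. *)
Lemma integral_esum (D : set T) : measurable D ->
  \int[mu]_(x in D) (\esum_(i in [set: I]) f i x) =
  \esum_(i in [set: I]) \int[mu]_(x in D) f i x.
Proof.
move=> mD; rewrite esum_pickle; last first.
  by move=> i; apply: integral_ge0.
rewrite seriesE integral_nneseries//=; last first.
  by move=> k; exact: measurable_funTS.
by apply: eq_eseriesr => k _; case: pickle_inv => //=; exact: integral0.
Qed.

End countable_sums.

(** A countable union of null sets is null. This is how identities proved letter by letter become
    valid for all letters off one null set. *)
Lemma ae_countable (R : realType) (I : countType) (d : measure_display)
    (T : measurableType d) (mu : {measure set T -> \bar R})
    (Q : I -> T -> Prop) :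
  (forall i, {ae mu, forall x, Q i x}) -> {ae mu, forall x i, Q i x}.
Proof.
move=> aeQ.
have /choice[N hN] : forall i, exists N, [/\ measurable N, mu N = 0%E &
    ~` [set x | Q i x] `<=` N].
  by move=> i; have [N] := aeQ i; exists N.
have : mu.-negligible (\bigcup_k oapp N set0 (pickle_inv (T:=I) k)).
  apply: negligible_bigcup => k; case: pickle_inv => [i|] /=.
    by have [mN N0 _] := hN i; exists (N i); split.
  exact: negligible_set0.
apply: negligibleS => x /existsNP[i Qx]; exists (pickle i) => //.
by rewrite pickleK_inv/=; have [_ _] := hN i; apply.
Qed.

Lemma aeI (R : realType) (d : measure_display) (T : measurableType d)
    (mu : {measure set T -> \bar R}) (Q1 Q2 : T -> Prop) :
  {ae mu, forall x, Q1 x} -> {ae mu, forall x, Q2 x} ->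
  {ae mu, forall x, Q1 x /\ Q2 x}.
Proof. by apply: filterS2 => x. Qed.

(** Inversion is the power with exponent -1, also at 0, where both give 0. *)
Lemma ge0_measurable_funV (R : realType) (d : measure_display)
    (T : measurableType d) (f : T -> R) : (forall x, 0 <= f x) ->
  measurable_fun [set: T] f -> measurable_fun [set: T] (fun x => (f x)^-1).
Proof.
move=> f0 mf; under eq_fun do rewrite -powR_inv1//.
by apply: (@measurableT_comp _ _ _ _ _ _ (@powR R ^~ (-1))) => //;
  exact: measurable_powR.
Qed.

(** * Comparison of densities and integration against a density *)

Section densities.
Context (R : realType) (d : measure_display) (T : measurableType d).
Local Open Scope ereal_scope.

(** On the set where [v < u], the function [u - v] is positive, yet its integral is at most 0; hence
    that set is null. *)
Lemma ae_le_integral (mu : {measure set T -> \bar R}) (u v : T -> R) :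
  mu.-integrable [set: T] (EFin \o u) -> mu.-integrable [set: T] (EFin \o v) ->
  (forall B, measurable B ->
     \int[mu]_(x in B) (u x)%:E <= \int[mu]_(x in B) (v x)%:E) ->
  {ae mu, forall x, (u x <= v x)%R}.
Proof.
move=> iu iv uv.
have mu' : measurable_fun [set: T] u.
  by apply/measurable_EFinP; exact: measurable_int iu.
have mv : measurable_fun [set: T] v.
  by apply/measurable_EFinP; exact: measurable_int iv.
pose E := [set x | (v x < u x)%R].
have mE : measurable E.
  rewrite -[E]setTI; have -> : E = (fun x => v x < u x)%R @^-1` [set true] by [].
  exact: measurable_fun_ltr.
have i0 : \int[mu]_(x in E) `|(u x - v x)%:E| = 0.
  apply/eqP; rewrite eq_le integral_ge0// andbT.
  under eq_integral => x xE.
    rewrite gee0_abs; last by rewrite lee_fin subr_ge0 ltW//; exact: set_mem xE.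
    rewrite EFinB; over.
  rewrite integralB//=; [|exact: integrableS iu|exact: integrableS iv].
  rewrite sube_le0; exact: uv.
have := (ae_eq_integral_abs mu mE _).1 i0.
move=> /(_ _)[].
  apply: measurable_funTS; apply/measurable_EFinP; exact: measurable_funB.
move=> N [mN N0 EN]; exists N; split => // x /= /negP; rewrite -ltNge => vu.
by apply: EN => /= /(_ vu)[] /eqP; rewrite subr_eq0 gt_eqF.
Qed.

(** By uniqueness, [p] agrees almost everywhere with the Radon-Nikodym derivative, for which the
    change of variables is known. *)
Lemma integral_density (mu : {sigma_finite_measure set T -> \bar R})
    (nu : {measure set T -> \bar R}) (p : T -> R) :
  fin_num_fun nu -> (forall x, 0 <= p x)%R -> measurable_fun [set: T] p ->
  (forall B, measurable B -> nu B = \int[mu]_(x in B) (p x)%:E) ->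
  forall (B : set T) (g : T -> \bar R), measurable B ->
    (forall x, 0 <= g x) -> measurable_fun [set: T] g ->
  \int[nu]_(x in B) g x = \int[mu]_(x in B) (g x * (p x)%:E).
Proof.
move=> nufin p0 mp nup' B g mB g0 mg.
(* The finiteness of [nu] is packed into a structure, the form in which a measure has a
   Radon-Nikodym derivative. *)
pose Hf := isFinite.Build _ _ _ _ nufin.
have sf : sigma_finite [set: T] nu.
  by apply: fin_num_fun_sigma_finite => //; rewrite measure0.
pose Hs := isSigmaFinite.Build _ _ _ _ sf.
pose Hsf := isSFinite.Build _ _ _ _ (sfinite_measure_sigma_finite sf).
pose nu' := HB.pack_for (FiniteMeasure.type T R) (Measure.sort nu) Hf Hs Hsf.
rewrite (@eq_measure_integral _ _ _ _ nu')//.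
have nup A : measurable A -> nu' A = \int[mu]_(x in A) (p x)%:E by exact: nup'.
move: nu' nup => {nu nufin nup' Hf sf Hs Hsf} nu nup.
have numu : nu `<< mu.
  apply/null_content_dominatesP => A mA A0; rewrite nup//.
  apply/eqP; rewrite eq_le integral_ge0 ?andbT; last by move=> *; rewrite lee_fin.
  rewrite -[leRHS](@integral_abs_eq0 _ _ _ mu A (fun x => (p x)%:E))//.
    by apply: ge0_le_integral => //; [move=> *; rewrite lee_fin
      |apply: measurable_funTS; exact/measurable_EFinP
      |apply: measurable_funTS; apply: measurableT_comp => //; exact/measurable_EFinP
      |move=> x _; rewrite lee_fin ler_norm].
  by apply: measurable_funTS; exact/measurable_EFinP.
rewrite -(Radon_Nikodym_SigmaFinite.change_of_variables numu)//; last first.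
  exact: measurable_funTS.
have mRN := measurable_int _ (Radon_Nikodym_SigmaFinite.f_integrable numu).
apply: ae_eq_integral => //.
- by apply: emeasurable_funM; apply: measurable_funTS.
- apply: emeasurable_funM; apply: measurable_funTS => //.
  exact/measurable_EFinP.
- apply: ae_eqe_mul2l; apply: (ae_eq_subset (@subsetT _ B)).
  apply: integral_ae_eq => //.
  + exact: Radon_Nikodym_SigmaFinite.f_integrable.
  + exact/measurable_EFinP.
  + by move=> A _ mA; rewrite -nup// -Radon_Nikodym_SigmaFinite.f_integral.
Qed.

End densities.

(** * Measurable maps and discrete targets *)

Lemma measurable_preimage (d1 d2 : measure_display) (T1 : measurableType d1)
    (T2 : measurableType d2) (V : {mfun T1 >-> T2}) (B : set T2) :
  measurable B -> measurable (V @^-1` B).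
Proof.
by move=> mB; rewrite -[X in measurable X]setTI; exact: measurable_funPT.
Qed.

Lemma measurable_to_discrete (d : measure_display) (T : measurableType d)
    (S : alphabetType) (f : T -> discrete S) :
  (forall y : S, measurable (f @^-1` [set y])) -> measurable_fun [set: T] f.
Proof.
move=> mf _ A _; rewrite setTI.
have -> : f @^-1` A = \bigcup_(y in A) (f @^-1` [set y]).
  by apply/seteqP; split=> [w Aw|w [y Ay /= ->//]]; exists (f w).
rewrite bigcup_mkcond; apply: countable_bigcupT_measurable => [|y].
  exact: countableP.
by case: ifPn.
Qed.

(** * Integration against conditional probabilities *)

Section conditional_law.
Context (R : realType) (d dL : measure_display).
Context (T : measurableType d) (L : measurableType dL) (P : probability T R).
Context (S : alphabetType) (Y : {mfun T >-> discrete S}) (Z : {mfun T >-> L}).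
Local Open Scope ereal_scope.

Local Notation PZ := (distribution P Z).

(** The derivative integrates over each measurable set to at most its mass, so it is at most 1
    almost everywhere, and the truncation in [cond_prob] changes no integral. *)
Lemma integral_cond_prob (A : set S) (B : set L) : measurable B ->
  \int[PZ]_(z in B) (cond_prob P Y Z A z)%:E = P (Y @^-1` A `&` Z @^-1` B).
Proof.
move=> mB; have numu := @event_law_dominates _ _ _ _ _ P S Y Z A.
pose f := Radon_Nikodym_SigmaFinite.f (event_law P Y Z A) PZ.
have f0 z : 0 <= f z by exact: Radon_Nikodym_SigmaFinite.f_ge0.
have ffin z : f z = (fine (f z))%:E.
  by rewrite fineK// Radon_Nikodym_SigmaFinite.f_fin_num.
have fint : PZ.-integrable [set: L] f.
  exact: Radon_Nikodym_SigmaFinite.f_integrable.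
have fE C : measurable C ->
    \int[PZ]_(z in C) (fine (f z))%:E = P (Y @^-1` A `&` Z @^-1` C).
  move=> mC; under eq_integral do rewrite -ffin.
  by rewrite -Radon_Nikodym_SigmaFinite.f_integral.
have f1 : {ae PZ, forall z, (fine (f z) <= 1)%R}.
  apply: (@ae_le_integral R _ L PZ (fine \o f) (cst 1%R)).
  - by apply: eq_integrable fint => // z _; exact: ffin.
  - exact: finite_measure_integrable_cst.
  - move=> C mC; rewrite [leLHS]fE// (integral_cst _ _ 1)// mul1e.
    apply: le_measure; rewrite ?inE; [|exact: measurable_preimage|exact: subIsetr].
    by apply: measurableI; exact: measurable_preimage.
rewrite -fE//; apply: ae_eq_integral => //.
- by apply/measurable_EFinP/measurable_funTS; exact: measurable_cond_prob.
- apply: measurable_funTS; rewrite -(_ : f = (fun z => (fine (f z))%:E)).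
    exact: measurable_int fint.
  by apply/funext.
- apply: filterS f1 => z f1 _; congr EFin.
  by rewrite /cond_prob; apply/min_idPr.
Qed.

Lemma integrable_cond_prob (A : set S) :
  PZ.-integrable [set: L] (fun z => (cond_prob P Y Z A z)%:E).
Proof.
apply: (@le_integrable _ _ _ PZ _ measurableT _ (EFin \o cst 1%R)).
- by apply/measurable_EFinP; exact: measurable_cond_prob.
- move=> z _; rewrite gee0_abs ?lee_fin ?cond_prob_ge0//=.
  by rewrite normr1 cond_prob_le1.
- exact: finite_measure_integrable_cst.
Qed.

(** The integrand splits along the countably many fibres of [Y], on each of which the letter is
    constant. *)
Lemma integral_comp_discrete (h : S -> T -> \bar R) :
  (forall y w, 0 <= h y w) -> (forall y, measurable_fun [set: T] (h y)) ->
  measurable_fun [set: T] (fun w => h (Y w) w) /\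
  \int[P]_w h (Y w) w =
    \esum_(y in [set: S]) \int[P]_(w in Y @^-1` [set y]) h y w.
Proof.
move=> h0 mh.
have hE : (fun w => h (Y w) w) =
    (fun w => \esum_(y in [set: S]) ((h y) \_ (Y @^-1` [set y])) w).
  apply/funext => w; rewrite -[LHS](@esum_set1 _ S (Y w) (fun y => h y w))//.
  rewrite esum_mkcond; apply: eq_esum => y _.
  rewrite patchE; congr (if _ then _ else _).
  by apply/idP/idP; rewrite !inE /= => ->.
have m1 y : measurable (Y @^-1` [set y]).
  exact: (@measurable_preimage _ _ _ _ Y [set y] I).
have r0 y w : 0 <= ((h y) \_ (Y @^-1` [set y])) w.
  by apply: erestrict_ge0 => *; exact: h0.
have mr y : measurable_fun [set: T] ((h y) \_ (Y @^-1` [set y])).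
  apply/(measurable_restrictT _ (m1 y)).
  exact: measurable_funTS (mh y).
rewrite hE; split; first exact: measurable_esum.
by rewrite integral_esum//; apply: eq_esum => y _; rewrite -integral_mkcond.
Qed.

Section disintegration.
Variable g : S -> L -> \bar R.
Hypotheses (g0 : forall y z, 0 <= g y z)
           (mg : forall y, measurable_fun [set: L] (g y)).

Let mgZ y : measurable_fun [set: T] (fun w => g y (Z w)).
Proof. by apply: measurableT_comp => //; exact: measurable_funPT. Qed.

Lemma measurable_disintegration :
  measurable_fun [set: T] (fun w => g (Y w) (Z w)).
Proof. by have [] := integral_comp_discrete (fun y w => g0 y (Z w)) mgZ. Qed.

(** On the fibre over [y], the law of [Z] is [event_law] of the singleton [y], whose density with
    respect to the law of [Z] is [cond_pmf]. This formula turns every mean below into sums and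
    integrals over the law of [Z]. *)
Lemma integral_disintegration :
  \int[P]_w g (Y w) (Z w) =
  \esum_(y in [set: S]) \int[PZ]_z (g y z * (cond_pmf P Y Z y z)%:E).
Proof.
have [_ ->] := integral_comp_discrete (fun y w => g0 y (Z w)) mgZ.
apply: eq_esum => y _; have mY := @measurable_preimage _ _ _ _ Y [set y] I.
rewrite -(@integral_density _ _ _ PZ (event_law P Y Z [set y]))//; last first.
- by move=> B mB; rewrite integral_cond_prob.
- exact: measurable_cond_prob.
- by move=> z; exact: cond_prob_ge0.
(* The event law is the image under [Z] of [P] restricted to the fibre, and that restriction has the
   indicator of the fibre as density. *)
rewrite (@eq_measure_integral _ _ _ _ (pushforward (mrestr P mY) Z)); last first.
  by move=> B mB _; exact: (congr1 P (setIC _ _)).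
rewrite ge0_integral_pushforward// preimage_setT.
rewrite [RHS](@integral_density _ _ _ P _ (\1_(Y @^-1` [set y])))//.
- rewrite integral_mkcond; apply: eq_integral => w _.
  by rewrite epatch_indic.
- by move=> B mB; rewrite /= /mrestr integral_indic// setIC.
- by move=> w; exact: g0.
- exact: mgZ.
Qed.

End disintegration.

End conditional_law.

(** * Pairs of discrete random variables *)

HB.instance Definition _ := Countable.on unit.
HB.instance Definition _ (A B : alphabetType) := Countable.on (A * B)%type.

Section pair_rv.
Context (d : measure_display) (T : measurableType d) (A B : alphabetType).
Context (U : {mfun T >-> discrete A}) (V : {mfun T >-> discrete B}).

Definition pair_rv (w : T) : discrete (A * B)%type := (U w, V w).

Let measurable_pair_rv : measurable_fun [set: T] pair_rv.
Proof.
apply: measurable_to_discrete => -[u v].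
have -> : pair_rv @^-1` [set (u, v)] = U @^-1` [set u] `&` V @^-1` [set v].
  by apply/seteqP; split=> [w [/= -> ->]|w [/= Uu Vv]]; rewrite /pair_rv /= ?Uu ?Vv.
apply: measurableI; first exact: (@measurable_preimage _ _ _ _ U [set u] I).
exact: (@measurable_preimage _ _ _ _ V [set v] I).
Qed.

HB.instance Definition _ :=
  isMeasurableFun.Build _ _ _ _ pair_rv measurable_pair_rv.

End pair_rv.

(** * Conditional mass functions: marginals, positivity, entropy *)

Section conditional_pmf.
Context (R : realType) (d dL : measure_display).
Context (T : measurableType d) (L : measurableType dL) (P : probability T R).
Context (Z : {mfun T >-> L}).
Local Open Scope ereal_scope.

Local Notation PZ := (distribution P Z).

(** For each [v] both sides have the same integral over every measurable set, by disintegration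
    along [W]. *)
Lemma cond_pmf_marginal (A B : alphabetType) (W : {mfun T >-> discrete A})
    (V : {mfun T >-> discrete B}) (phi : A -> B) :
  (forall w, V w = phi (W w)) ->
  {ae PZ, forall z v, \esum_(a in phi @^-1` [set v]) (cond_pmf P W Z a z)%:E =
                      (cond_pmf P V Z v z)%:E}.
Proof.
move=> VW; apply: (@ae_countable R B _ _ PZ) => v.
have mp a : measurable_fun [set: L] (fun z => (cond_pmf P W Z a z)%:E).
  by apply/measurable_EFinP; exact: measurable_cond_prob.
pose q a z := if a \in phi @^-1` [set v] then (cond_pmf P W Z a z)%:E else 0.
have q0 a z : 0 <= q a z.
  by rewrite /q; case: ifP => _ //; rewrite lee_fin cond_prob_ge0.
have mq a : measurable_fun [set: L] (q a).
  by rewrite /q; case: (a \in phi @^-1` [set v]) => //; exact: measurable_cst.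
suff : ae_eq PZ [set: L] (fun z => (cond_pmf P V Z v z)%:E)
    (fun z => \esum_(a in [set: A]) q a z).
  by apply: filterS => z /(_ I) /= ->; rewrite esum_mkcond.
apply: integral_ae_eq => //.
- exact: integrable_cond_prob.
- exact: measurable_esum.
- move=> D _ mD; rewrite integral_cond_prob// integral_esum//.
  (* Evaluated at [W] and [Z], this is the indicator of the event that [V] equals [v] and [Z] lies
     in [D]. *)
  pose g a z := if a \in phi @^-1` [set v] then (\1_D z)%:E else 0 : \bar R.
  have g0 a z : 0 <= g a z by rewrite /g; case: ifP => // _; rewrite lee_fin.
  have mg a : measurable_fun [set: L] (g a).
    rewrite /g; case: (a \in phi @^-1` [set v]); last exact: measurable_cst.
    by apply/measurable_EFinP.
  have -> : P (V @^-1` [set v] `&` Z @^-1` D) = \int[P]_w g (W w) (Z w).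
    have mVD : measurable (V @^-1` [set v] `&` Z @^-1` D).
      apply: measurableI; last exact: measurable_preimage.
      exact: (@measurable_preimage _ _ _ _ V [set v] I).
    rewrite -[V @^-1` _ `&` _]setIT -integral_indic//; apply: eq_integral => w _.
    rewrite /g indicE in_setI.
    have -> : (w \in V @^-1` [set v]) = (W w \in phi @^-1` [set v]).
      by apply/idP/idP; rewrite !inE/= VW.
    by case: (_ \in phi @^-1` _) => //=; rewrite indicE.
  rewrite integral_disintegration//; apply: eq_esum => a _.
  rewrite [RHS]integral_mkcond; apply: eq_integral => z _.
  rewrite /g /q patchE; case: ifP => // _; rewrite ?mul0e ?if_same//.
  by rewrite indicE; case: ifP => _; rewrite ?mul1e ?mul0e.
Qed.

Lemma cond_pmf_marginal_le (A B : alphabetType) (W : {mfun T >-> discrete A})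
    (V : {mfun T >-> discrete B}) (phi : A -> B) :
  (forall w, V w = phi (W w)) ->
  {ae PZ, forall z a, (cond_pmf P W Z a z <= cond_pmf P V Z (phi a) z)%R}.
Proof.
move=> /cond_pmf_marginal; apply: filterS => z mz a.
rewrite -lee_fin -mz; apply: esum_ge; exists [set a].
  by split; [exact: finite_set1|move=> _ ->].
by rewrite fsbig_set1.
Qed.

Context (S : alphabetType) (Y : {mfun T >-> discrete S}).

(** The total mass is the marginal along the map to the one-point alphabet, and every [cond_prob] is
    at most 1. *)
Lemma esum_cond_pmf_le1 :
  {ae PZ, forall z, \esum_(y in [set: S]) (cond_pmf P Y Z y z)%:E <= 1}.
Proof.
have := @cond_pmf_marginal S unit Y (cst (tt : discrete unit)) (fun=> tt)
  (fun=> erefl).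
apply: filterS => z /(_ tt) /=.
rewrite (_ : (fun=> tt) @^-1` [set tt] = [set: S]); last exact/seteqP.
by move=> ->; rewrite lee_fin cond_prob_le1.
Qed.

(** Disintegrating the indicator that the mass vanishes gives terms of the form indicator of [p = 0]
    times [p], all zero. *)
Lemma cond_pmf_gt0 : {ae P, forall w, (0 < cond_pmf P Y Z (Y w) (Z w))%R}.
Proof.
pose g y z := (if cond_pmf P Y Z y z == 0%R then 1 else 0) : \bar R.
have g0 y z : 0 <= g y z by rewrite /g; case: ifP.
have mg y : measurable_fun [set: L] (g y).
  apply: measurable_fun_ifT => //.
  apply: measurable_fun_eqr => //; exact: measurable_cond_prob.
have : \int[P]_w `|g (Y w) (Z w)| = 0.
  under eq_integral do rewrite gee0_abs//.
  rewrite integral_disintegration//; apply: esum1 => y _.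
  apply: integral0_eq => z _; rewrite /g.
  by case: eqP => [->|_]; rewrite ?mule0 ?mul0e.
move=> /(ae_eq_integral_abs P measurableT (measurable_disintegration P Y Z g0 mg)).
apply: filterS => w /(_ I); rewrite /g lt0r cond_prob_ge0 andbT.
by case: ifP => // _ /= [] /eqP; rewrite oner_eq0.
Qed.

(** The entropy is the mean of the surprisal. For [b > 1] the surprisal is nonnegative, so it can be
    disintegrated and sum and integral exchanged. *)
Lemma cond_entropyE (b : R) : (1 < b)%R -> cond_entropy b P Y Z =
  \int[P]_w (- (ln (cond_pmf P Y Z (Y w) (Z w)) / ln b))%:E.
Proof.
move=> b1; have lnb : (0 < ln b)%R by rewrite ln_gt0.
pose g y z := (- (ln (cond_pmf P Y Z y z) / ln b))%:E.
have g0 y z : 0 <= g y z.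
  by rewrite lee_fin oppr_ge0 pmulr_lle0 ?invr_gt0// ln_le0// cond_prob_le1.
have mg y : measurable_fun [set: L] (g y).
  apply/measurable_EFinP; apply: measurable_funN.
  apply: measurable_funM => //; apply: measurableT_comp => //.
  exact: measurable_cond_prob.
rewrite -[RHS]/(\int[P]_w g (Y w) (Z w)) integral_disintegration//.
rewrite /cond_entropy; under eq_integral.
  move=> z _; under eq_esum => y _.
    have -> : (- (cond_pmf P Y Z y z * (ln (cond_pmf P Y Z y z) / ln b)))%:E =
      g y z * (cond_pmf P Y Z y z)%:E by rewrite /g -EFinM mulNr mulrC.
    over.
  over.
rewrite integral_esum//.
- by move=> y z; rewrite mule_ge0// lee_fin cond_prob_ge0.
- move=> y; apply: emeasurable_funM => //.
  by apply/measurable_EFinP; exact: measurable_cond_prob.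
Qed.

End conditional_pmf.

(** * Sums of products over tuples of letters *)

Section product_sums.
Context (R : realType) (n : nat) (S : 'I_n -> alphabetType).

(** A finite set of tuples uses finitely many letters, so it embeds into a finite box of codes,
    where a product of sums expands into a sum of products. *)
Lemma esum_prod_le (g : forall j, S j -> R) (c : 'I_n -> R) :
  (forall j s, 0 <= g j s) ->
  (forall j, \esum_(s in [set: S j]) (g j s)%:E <= (c j)%:E)%E ->
  (\esum_(x in [set: {dffun forall j, S j}]) (\prod_(j < n) g j (x j))%:E <=
    (\prod_(j < n) c j)%:E)%E.
Proof.
move=> g0 gc; apply: ge_ereal_sup => _ [/= A [finA _] <-].
rewrite fsbig_finite//= sumEFin lee_fin.
set r := finmap.enum_fset _; have ur : uniq r by exact: finmap.fset_uniq.
(* [N] is the largest code in use, whence the index type ['I_N.+1], on which [inord] loses nothing.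
   [G] extends [g] by 0 to codes of no letter. *)
pose N := \max_(x <- r) \max_(j < n) pickle (x j).
have leN (x : {dffun forall j, S j}) j :
    x \in r -> (pickle (x j) < N.+1)%N.
  move=> xA; rewrite ltnS; apply: leq_trans (leq_bigmax_seq _ xA _) => //.
  exact: (leq_bigmax j).
pose G j (k : 'I_N.+1) := oapp (g j) 0 (pickle_inv (T:=S j) k).
have G0 j k : 0 <= G j k by rewrite /G; case: pickle_inv => /=.
pose e (x : {dffun forall j, S j}) : {ffun 'I_n -> 'I_N.+1} :=
  [ffun j => inord (pickle (x j))].
have ge x j : x \in r -> g j (x j) = G j (e x j).
  by move=> xA; rewrite /G ffunE inordK ?leN// pickleK_inv.
have einj : {in r &, injective e}.
  move=> x y xA yA /ffunP exy; apply/ffunP => j; move: (exy j).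
  rewrite !ffunE => /(congr1 val); rewrite /= !inordK ?leN//.
  exact: (pcan_inj pickleK).
apply: (@le_trans _ _ (\prod_(j < n) \sum_(k < N.+1) G j k)); last first.
  apply: ler_prod => j _; rewrite sumr_ge0//= -lee_fin.
  apply: le_trans (gc j); rewrite esum_pickle => [|s]; last by rewrite lee_fin.
  rewrite -sumEFin.
  rewrite (eq_bigr (fun k : 'I_N.+1 =>
      oapp (EFin \o g j) 0%E (pickle_inv (T:=S j) k))); last first.
    by move=> k _; rewrite /G; case: pickle_inv.
  rewrite -(big_mkord xpredT (fun k =>
      oapp (EFin \o g j) 0%E (pickle_inv (T:=S j) k))).
  apply: nneseries_lim_ge => k _ _.
  by case: pickle_inv => //= s; rewrite lee_fin.
(* The expanded product runs over all code vectors; those coming from the finite set are distinct,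
   and the others contribute nonnegative terms. *)
rewrite bigA_distr_bigA/=.
rewrite (eq_big_seq (fun x => \prod_j G j (e x j))); last first.
  by move=> x xA; apply: eq_bigr => j _; exact: ge.
rewrite -(big_map e xpredT (fun f => \prod_j G j (f j))).
rewrite big_uniq/=; last by rewrite map_inj_in_uniq// ur.
rewrite [leRHS](bigID (mem (map e ((r : seq _)))))/= lerDl.
by apply: sumr_ge0 => f _; exact: prodr_ge0.
Qed.

End product_sums.

(** * Integrable variables with bounded mean *)

Section bounded_expectations.
Context (R : realType) (d : measure_display) (T : measurableType d).
Context (P : probability T R).
Local Open Scope ereal_scope.

Implicit Types (u v : T -> R) (c k : R).

(** Integrability is carried along so that bounds for terms of either sign can be added. *)
Definition mean_le (u : T -> R) (c : R) : Prop :=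
  P.-integrable [set: T] (EFin \o u) /\ \int[P]_w (u w)%:E <= c%:E.

Lemma mean_le_ge0 u c : measurable_fun [set: T] u -> (forall w, 0 <= u w)%R ->
  \int[P]_w (u w)%:E <= c%:E -> mean_le u c.
Proof.
move=> mu u0 uc; split=> //; apply/integrableP; split.
  exact/measurable_EFinP.
under eq_integral do rewrite gee0_abs ?lee_fin//.
exact: le_lt_trans uc (ltry _).
Qed.

Lemma mean_leD u v c c' :
  mean_le u c -> mean_le v c' -> mean_le (fun w => u w + v w)%R (c + c')%R.
Proof.
move=> [iu uc] [iv vc]; split; first exact: (integrableD measurableT iu iv).
by rewrite integralD_EFin// EFinD leeD.
Qed.

Lemma mean_leZ k u c : (0 <= k)%R ->
  mean_le u c -> mean_le (fun w => k * u w)%R (k * c)%R.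
Proof.
move=> k0 [iu uc]; split; first exact: (integrableZl measurableT k iu).
by under eq_integral do rewrite EFinM; rewrite integralZl// EFinM lee_wpmul2l.
Qed.

Lemma mean_le_cst c : mean_le (cst c) c.
Proof.
split; first exact: finite_measure_integrable_cst.
rewrite [leRHS](_ : _ = c%:E * P [set: T]); last by rewrite probability_setT mule1.
by rewrite -integral_cst.
Qed.

(** Since [v] is nonnegative only almost everywhere, it is replaced by its absolute value before
    integrals are compared. *)
Lemma mean_le_ae u v c : measurable_fun [set: T] u -> (forall w, 0 <= u w)%R ->
  {ae P, forall w, (u w <= v w)%R} -> mean_le v c -> \int[P]_w (u w)%:E <= c%:E.
Proof.
move=> mu u0 uv [iv vc]; apply: le_trans vc; have mv := measurable_int _ iv.
rewrite [leRHS](@ae_eq_integral _ _ _ P _ (fun w => `|(v w)%:E|))//.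
- apply: ae_ge0_le_integral => //.
  + by move=> w _; rewrite lee_fin.
  + exact/measurable_EFinP.
  + exact: measurableT_comp.
  + apply: filterS uv => w uv _.
    by rewrite /= lee_fin ger0_norm// (le_trans (u0 w)).
- exact: measurableT_comp.
- apply: filterS uv => w uv _ /=.
  by rewrite ger0_norm// (le_trans (u0 w)).
Qed.

(** The negative part is dominated by the integrable [v]; an infinite positive part would then make
    the whole integral infinite, against the bound [c]. *)
Lemma mean_le_funeneg u v c c' : measurable_fun [set: T] u ->
  mean_le v c' -> (forall w, 0 <= v w)%R -> (forall w, - u w <= v w)%R ->
  \int[P]_w (u w)%:E <= c%:E -> mean_le u c.
Proof.
move=> mu [iv _] v0 uv uc; split=> //.
have mEu : measurable_fun [set: T] (EFin \o u) by exact/measurable_EFinP.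
have neg_fin : \int[P]_w (EFin \o u)^\- w < +oo.
  apply: (@le_lt_trans _ _ (\int[P]_w (v w)%:E)); last first.
    by have /integrableP[_] := iv; under eq_integral do rewrite gee0_abs ?lee_fin//.
  apply: ge0_le_integral => //.
  - by apply: measurable_funeneg.
  - exact: measurable_int iv.
  - by move=> w _; rewrite funenegE ge_max /= !lee_fin uv v0.
have pos_fin : \int[P]_w (EFin \o u)^\+ w < +oo.
  rewrite ltey; apply/eqP => pos; move: uc.
  rewrite [X in X <= _](integralE P _ (EFin \o u)) pos addye ?leye_eq//.
  by apply/eqP => /(congr1 oppe); rewrite oppeK /= => E; rewrite E in neg_fin.
apply/integrableP; split => //.
under eq_integral => w _ do rewrite -/((abse \o (EFin \o u)) w) fune_abse.
rewrite ge0_integralD//; first exact: lte_add_pinfty.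
- exact: measurable_funepos.
- exact: measurable_funeneg.
Qed.

End bounded_expectations.

Lemma ae_distribution (R : realType) (d dL : measure_display)
    (T : measurableType d) (L : measurableType dL) (P : probability T R)
    (Z : {mfun T >-> L}) (Q : L -> Prop) :
  {ae distribution P Z, forall z, Q z} -> {ae P, forall w, Q (Z w)}.
Proof.
move=> [N [mN N0 QN]]; exists (Z @^-1` N); split=> //.
  exact: measurable_preimage.
by move=> w /= nQ; apply: QN.
Qed.

(** * The ratios [t_1] and [t_2], each attached to one observation *)

Section swap_ratio.
Context (R : realType) (d dL : measure_display).
Context (T : measurableType d) (L : measurableType dL) (P : probability T R).
Context (n : nat) (S : 'I_n -> alphabetType) (S' : alphabetType).
Context (X : forall j : 'I_n, {mfun T >-> discrete (S j)}).
Context (Z : {mfun T >-> L}) (Y : {mfun T >-> discrete S'}).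
Local Open Scope ereal_scope.

Local Notation PZ := (distribution P Z).

Lemma measurable_cond_pmfV (A : alphabetType) (V : {mfun T >-> discrete A}) a :
  measurable_fun [set: L] (fun z => (cond_pmf P V Z a z)^-1)%R.
Proof.
apply: ge0_measurable_funV; last exact: measurable_cond_prob.
by move=> z; exact: cond_prob_ge0.
Qed.

Lemma measurable_cond_pmf_rv (dM : measure_display) (M : measurableType dM)
    (V : {mfun T >-> M}) (A : alphabetType) (W : {mfun T >-> discrete A}) :
  measurable_fun [set: T] (fun w => cond_pmf P W V (W w) (V w)).
Proof.
apply/measurable_EFinP.
apply: (@measurable_disintegration _ _ _ _ _ P _ W V
  (fun a z => (cond_pmf P W V a z)%:E)).
- by move=> a z; rewrite lee_fin cond_prob_ge0.
- by move=> a; apply/measurable_EFinP; exact: measurable_cond_prob.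
Qed.

Section one_observation.
Variable j : 'I_n.
Local Notation XY := (pair_rv (X j) Y).

(** The numerator is the conditional mass that the pair would have if [Y] depended on [Z] only
    through [X j]; the denominator is its true conditional mass. *)
Definition swap_ratio (s : S j) (y : S') (z : L) : R :=
  (cond_pmf P Y (X j) y s * cond_pmf P (X j) Z s z / cond_pmf P XY Z (s, y) z)%R.

Lemma swap_ratio_ge0 s y z : (0 <= swap_ratio s y z)%R.
Proof. by rewrite /swap_ratio !mulr_ge0// ?invr_ge0 cond_prob_ge0. Qed.

(** Disintegration along the pair cancels the denominator. What remains is a sum of P(Y | X_j) P(X_j
    | Z), at most 1 when summed first over [y], then over [s]. *)
Lemma mean_swap_ratio :
  mean_le P (fun w => swap_ratio (X j w) (Y w) (Z w)) 1.
Proof.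
pose g (c : S j * S') z := (swap_ratio c.1 c.2 z)%:E.
have g0 c z : 0 <= g c z by rewrite lee_fin swap_ratio_ge0.
have mg c : measurable_fun [set: L] (g c).
  apply/measurable_EFinP; apply: measurable_funM; last exact: measurable_cond_pmfV.
  by apply: measurable_funM => //; exact: measurable_cond_prob.
apply: mean_le_ge0.
- apply/measurable_EFinP; exact: (@measurable_disintegration _ _ _ _ _ P _ XY Z g).
- by move=> w; exact: swap_ratio_ge0.
rewrite -[leLHS]/(\int[P]_w g (XY w) (Z w)) integral_disintegration//.
pose q s y z := (cond_pmf P Y (X j) y s * cond_pmf P (X j) Z s z)%R.
apply: (@le_trans _ _
    (\esum_(c in [set: S j * S']) \int[PZ]_z (q c.1 c.2 z)%:E)).
  apply: le_esum => -[s y] _; apply: ge0_le_integral => //.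
  - by move=> z _; rewrite mule_ge0// lee_fin cond_prob_ge0.
  - apply: emeasurable_funM => //; apply/measurable_EFinP.
    exact: measurable_cond_prob.
  - apply/measurable_EFinP; apply: measurable_funM => //.
    exact: measurable_cond_prob.
  - move=> z _; rewrite lee_fin /swap_ratio /=.
    (* Where the true mass vanishes the term is 0, which makes this an inequality only. *)
    have [->|a0] := eqVneq (cond_pmf P XY Z (s, y) z) 0%R.
      by rewrite mulr0 mulr_ge0// cond_prob_ge0.
    by rewrite divfK.
have -> : [set: S j * S'] = [set: S j] `*`` (fun=> [set: S']).
  by apply/seteqP; split.
rewrite -(@esum_esum _ (S j) S' _ _ (fun s y => \int[PZ]_z (q s y z)%:E)); last first.
  by move=> s y _ _; apply: integral_ge0 => z _; rewrite lee_fin mulr_ge0// cond_prob_ge0.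
pose h (s : S j) (z : L) := \esum_(y in [set: S']) (cond_pmf P Y (X j) y s)%:E.
have h0 s z : 0 <= h s z.
  by apply: esum_ge0 => y _; rewrite lee_fin cond_prob_ge0.
have h1 : {ae P, forall w, h (X j w) (Z w) <= 1}.
  exact: (ae_distribution (esum_cond_pmf_le1 P (X j) Y)).
(* The bound [h <= 1] is known only at almost every value of [X j], so the sum over [s] is read back
   as a mean under [P]. The second argument of [h] is a dummy that fits the disintegration along
   [Z]. *)
apply: (@le_trans _ _ (\int[P]_w h (X j w) (Z w))).
  rewrite integral_disintegration//.
    apply: le_esum => s _; have mqs y : measurable_fun [set: L]
        (fun z => (q s y z)%:E).
      apply/measurable_EFinP; apply: measurable_funM => //.
      exact: measurable_cond_prob.
    rewrite -integral_esum//; last first.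
      by move=> y z; rewrite lee_fin mulr_ge0// cond_prob_ge0.
    rewrite le_eqVlt; apply/orP; left; apply/eqP; apply: eq_integral => z _.
    rewrite muleC /h -ge0_esumZl ?cond_prob_ge0//; last first.
      by move=> y; rewrite lee_fin cond_prob_ge0.
    by apply: eq_esum => y _; rewrite -EFinM mulrC.
  by move=> s; exact: measurable_cst.
rewrite -[leRHS](_ : \int[P]_w cst 1%:E w = 1); last first.
  by rewrite integral_cst// mul1e; exact: probability_setT.
apply: ae_ge0_le_integral => //.
- by apply: measurable_disintegration => // s; exact: measurable_cst.
- by apply: filterS h1.
Qed.

End one_observation.

End swap_ratio.

(** * Densities with respect to the conditional product law, and the ratio [t_3] *)

Section product_density.
Context (R : realType) (d dL : measure_display).
Context (T : measurableType d) (L : measurableType dL) (P : probability T R).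
Context (n : nat) (S : 'I_n -> alphabetType) (S' : alphabetType).
Context (X : forall j : 'I_n, {mfun T >-> discrete (S j)}).
Context (Z : {mfun T >-> L}) (Y : {mfun T >-> discrete S'}).
Local Open Scope ereal_scope.

Local Notation PZ := (distribution P Z).
Local Notation tuples := {dffun forall j : 'I_n, S j}.

(** The sum in the last hypothesis is the conditional mean given [Z]; it is integrated over the law
    of [Z]. *)
Lemma mean_le1_cond_pmf (A : alphabetType) (W : {mfun T >-> discrete A})
    (G : A -> L -> R) :
  (forall a z, 0 <= G a z)%R -> (forall a, measurable_fun [set: L] (G a)) ->
  {ae PZ, forall z, \esum_(a in [set: A]) (G a z * cond_pmf P W Z a z)%:E <= 1} ->
  mean_le P (fun w => G (W w) (Z w)) 1.
Proof.
move=> G0 mG G1; pose g a z := (G a z)%:E.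
have g0 a z : 0 <= g a z by rewrite lee_fin.
have mg a : measurable_fun [set: L] (g a) by exact/measurable_EFinP.
apply: mean_le_ge0 => //.
  by apply/measurable_EFinP; exact: (@measurable_disintegration _ _ _ _ _ P _ W Z g).
rewrite -[leLHS]/(\int[P]_w g (W w) (Z w)) integral_disintegration//.
have gp0 a z : 0 <= g a z * (cond_pmf P W Z a z)%:E.
  by rewrite mule_ge0// lee_fin cond_prob_ge0.
have mgp a : measurable_fun [set: L] (fun z => g a z * (cond_pmf P W Z a z)%:E).
  apply: emeasurable_funM => //; apply/measurable_EFinP.
  exact: measurable_cond_prob.
rewrite -integral_esum// -[leRHS](_ : \int[PZ]_z cst 1%:E z = 1); last first.
  by rewrite integral_cst// mul1e; exact: probability_setT.
apply: ae_ge0_le_integral => //.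
- by move=> z _; apply: esum_ge0.
- exact: measurable_esum.
- by apply: filterS G1.
Qed.

Variable F : tuples -> L -> R.
Hypotheses (F0 : forall x z, (0 <= F x z)%R)
           (mF : forall x, measurable_fun [set: L] (F x))
           (FE : {ae PZ, forall z x, cond_pmf P (tuple_rv X) Z x z =
                                     (F x z * prod_pmf P X Z x z)%R}).

Let ae_pmf_le1 : {ae PZ, forall z j,
  \esum_(s in [set: S j]) (cond_pmf P (X j) Z s z)%:E <= 1}.
Proof. by apply: (@ae_countable R 'I_n) => j; exact: esum_cond_pmf_le1. Qed.

(** Dividing by [F] turns the conditional mass of the tuple into at most the product mass, whose sum
    is at most 1. Here [F] stays abstract so as to cover both the constant 1 and a Radon-Nikodym
    derivative. *)
Lemma mean_inv_density : mean_le P (fun w => (F (tuple_rv X w) (Z w))^-1)%R 1.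
Proof.
apply: (@mean_le1_cond_pmf _ (tuple_rv X) (fun x z => (F x z)^-1)%R).
- by move=> x z; rewrite invr_ge0.
- by move=> x; exact: ge0_measurable_funV.
apply: filterS2 FE ae_pmf_le1 => z Fz p1.
apply: (@le_trans _ _ (\esum_(x in [set: tuples]) (prod_pmf P X Z x z)%:E)).
  apply: le_esum => x _; rewrite lee_fin Fz mulrA.
  rewrite ler_piMl ?prod_pmf_ge0//.
  by have [->|f0] := eqVneq (F x z) 0%R; rewrite ?mulr0// mulVf.
rewrite -[leRHS](_ : (\prod_(j < n) 1)%:E = 1); last by rewrite big1_eq.
apply: (@esum_prod_le _ _ _ (fun j s => cond_pmf P (X j) Z s z) (fun=> 1%R)) => //.
by move=> j s; exact: cond_prob_ge0.
Qed.

Variables j1 j2 : 'I_n.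
Hypothesis j12 : j1 != j2.

(** Where nothing vanishes, multiplying by P(X | Z) gives a coupled law given [Z]: draw [Y], then
    the coordinates [j1] and [j2] independently given [Y] and [Z], and the other coordinates
    independently given [Z] alone. *)
Definition coupling_ratio (c : S' * tuples) (z : L) : R :=
  (cond_pmf P (pair_rv (X j1) Y) Z (c.2 j1, c.1) z *
   cond_pmf P (pair_rv (X j2) Y) Z (c.2 j2, c.1) z /
   (cond_pmf P (X j1) Z (c.2 j1) z * cond_pmf P (X j2) Z (c.2 j2) z *
    F c.2 z * cond_pmf P Y Z c.1 z))%R.

Lemma coupling_ratio_ge0 c z : (0 <= coupling_ratio c z)%R.
Proof.
by rewrite /coupling_ratio !mulr_ge0 ?invr_ge0 ?mulr_ge0 ?cond_prob_ge0.
Qed.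

(** Replacing P(Y, X | Z) by the larger P(X | Z) bounds the conditional mean by the mass of the
    coupled law. With p = P(Y = y | Z), summing over tuples gives at most p^2 / p, and then summing
    over [y] at most 1. *)
Lemma mean_coupling_ratio :
  mean_le P (fun w => coupling_ratio (Y w, tuple_rv X w) (Z w)) 1.
Proof.
apply: (@mean_le1_cond_pmf _ (pair_rv Y (tuple_rv X)) coupling_ratio).
- exact: coupling_ratio_ge0.
- move=> c; apply: measurable_funM.
    by apply: measurable_funM; exact: measurable_cond_prob.
  apply: ge0_measurable_funV => [z|].
    by rewrite !mulr_ge0 ?cond_prob_ge0.
  by do 3?[apply: measurable_funM => //]; exact: measurable_cond_prob.
have sndW := @cond_pmf_marginal_le _ _ _ _ _ P Z _ _
  (pair_rv Y (tuple_rv X)) (tuple_rv X) snd (fun=> erefl).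
have sndA : {ae PZ, forall z j y,
    \esum_(c in snd @^-1` [set y]) (cond_pmf P (pair_rv (X j) Y) Z c z)%:E =
    (cond_pmf P Y Z y z)%:E}.
  apply: (@ae_countable R 'I_n) => j.
  exact: (@cond_pmf_marginal _ _ _ _ _ P Z _ _ (pair_rv (X j) Y) Y snd
    (fun=> erefl)).
have Y1 := @esum_cond_pmf_le1 _ _ _ _ _ P Z _ Y.
have ae_all := aeI (aeI FE ae_pmf_le1) (aeI sndW (aeI sndA Y1)).
apply: filterS ae_all => z [[Fz r1] [pW [aY p1]]].
pose py y := cond_pmf P Y Z y z.
have py0 y : (0 <= py y)%R by exact: cond_prob_ge0.
(* For fixed [y] the coupled mass is a product over coordinates; only the factors at [j1] and [j2]
   involve [y]. *)
pose G y j (s : S j) := (if (j == j1) || (j == j2)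
  then cond_pmf P (pair_rv (X j) Y) Z (s, y) z else cond_pmf P (X j) Z s z)%R.
have G0 y j s : (0 <= G y j s)%R.
  by rewrite /G; case: ifP => _; exact: cond_prob_ge0.
have prodG y (x : tuples) : (0 <= \prod_(j < n) G y j (x j))%R.
  by apply: prodr_ge0.
apply: (@le_trans _ _ (\esum_(c in [set: S' * tuples])
    ((py c.1)^-1 * \prod_(j < n) G c.1 j (c.2 j))%:E)).
  apply: le_esum => -[y x] _; rewrite lee_fin /=.
  apply: (@le_trans _ _ (coupling_ratio (y, x) z *
      (F x z * prod_pmf P X Z x z))%R).
    by apply: ler_wpM2l; [exact: coupling_ratio_ge0|rewrite -Fz; exact: pW].
  rewrite /prod_pmf (bigD1 j1)//= (bigD1 j2) 1?eq_sym//=.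
  rewrite [in leRHS](bigD1 j1)//= [in leRHS](bigD1 j2) 1?eq_sym//=.
  rewrite [in leRHS](eq_bigr (fun j => cond_pmf P (X j) Z (x j) z)
    (P := fun j => (j != j1) && (j != j2))); last first.
    by move=> j /andP[/negbTE jj1 /negbTE jj2]; rewrite /G jj1 jj2.
  rewrite {1 2}/G !eqxx orbT /= /coupling_ratio /= -/(py y).
  set Q := (\prod_(j < n | _) _)%R; set A1 := cond_pmf _ (pair_rv (X j1) Y) _ _ _.
  set A2 := cond_pmf _ (pair_rv (X j2) Y) _ _ _.
  set f := F x z; set u1 := cond_pmf _ (X j1) _ _ _.
  set u2 := cond_pmf _ (X j2) _ _ _.
  have R0 : (0 <= (py y)^-1 * (A1 * (A2 * Q)))%R.
    by rewrite !mulr_ge0 ?invr_ge0 ?cond_prob_ge0//; apply: prodr_ge0 => *;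
      exact: cond_prob_ge0.
  (* If a factor of the denominator vanishes, the left side is 0 and the right side nonnegative;
     otherwise the two sides are equal. *)
  have [f0|f0] := eqVneq f 0%R; first by rewrite f0 !(mul0r, mulr0).
  have [u10|u10] := eqVneq u1 0%R; first by rewrite u10 !(mul0r, mulr0).
  have [u20|u20] := eqVneq u2 0%R; first by rewrite u20 !(mul0r, mulr0).
  have [y0|y0] := eqVneq (py y) 0%R; first by rewrite y0 !(mul0r, mulr0, invr0).
  by rewrite le_eqVlt; apply/orP; left; apply/eqP; field; rewrite f0 u10 u20 y0.
have -> : [set: S' * tuples] = [set: S'] `*`` (fun=> [set: tuples]).
  by apply/seteqP; split.
rewrite -(@esum_esum _ S' tuples _ _
  (fun y x => ((py y)^-1 * \prod_(j < n) G y j (x j))%:E)); last first.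
  by move=> y x _ _; rewrite lee_fin mulr_ge0// invr_ge0.
apply: le_trans p1; apply: le_esum => y _.
under eq_esum do rewrite EFinM.
rewrite ge0_esumZl; [|by rewrite invr_ge0|by move=> x; rewrite lee_fin].
apply: (@le_trans _ _ ((py y)^-1%:E * (py y * py y)%:E)); last first.
  rewrite -EFinM lee_fin -/(py y).
  by have [->|y0] := eqVneq (py y) 0%R; rewrite ?mulr0// mulrA mulVf ?mul1r.
rewrite lee_wpmul2l ?lee_fin ?invr_ge0//.
(* Summing out the letter at [j1] or [j2] leaves the marginal [py y]; at any other index the sum is
   at most 1. *)
pose c j := (if (j == j1) || (j == j2) then py y else 1)%R.
have -> : (py y * py y = \prod_(j < n) c j)%R.
  rewrite (bigD1 j1)//= (bigD1 j2) 1?eq_sym//= big1 ?mulr1.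
    by rewrite /c !eqxx orbT.
  by move=> j /andP[/negbTE jj1 /negbTE jj2]; rewrite /c jj1 jj2.
apply: esum_prod_le => // j; rewrite /G /c; case: ifP => _; last exact: r1.
rewrite /py -(aY j) (_ : snd @^-1` [set y] = (fun s => (s, y)) @` [set: S j]).
  rewrite esum_image//; first by move=> s s' _ _ [].
by apply/seteqP; split=> [[s _] /= ->|_ [s _ <-]//]; exists s.
Qed.

End product_density.

(** * The entropy bound from the three ratios *)

Section redundancy_bound.
Context (R : realType) (b : R) (b_gt1 : 1 < b) (d dL : measure_display).
Context (T : measurableType d) (L : measurableType dL) (P : probability T R).
Context (n : nat) (S : 'I_n -> alphabetType) (S' : alphabetType).
Context (X : forall j : 'I_n, {mfun T >-> discrete (S j)}).
Context (Z : {mfun T >-> L}) (Y : {mfun T >-> discrete S'}).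
Local Open Scope ereal_scope.

Let lnb_gt0 : (0 < ln b)%R. Proof. by rewrite ln_gt0. Qed.

Lemma ln_le_subr1 (x : R) : (0 < x)%R -> (ln x <= x - 1)%R.
Proof.
move=> x0; have := @le_ln1Dx _ (x - 1)%R.
by rewrite addrCA subrr addr0; apply; rewrite ltrBrDl addrN.
Qed.

Lemma surprisal_ge0 (dM : measure_display) (M : measurableType dM)
    (V : {mfun T >-> M}) y v : (0 <= - (ln (cond_pmf P Y V y v) / ln b))%R.
Proof. by rewrite oppr_ge0 pmulr_lle0 ?invr_gt0// ln_le0// cond_prob_le1. Qed.

Lemma measurable_surprisal (dM : measure_display) (M : measurableType dM)
    (V : {mfun T >-> M}) :
  measurable_fun [set: T] (fun w => - (ln (cond_pmf P Y V (Y w) (V w)) / ln b))%R.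
Proof.
apply: measurable_funN; apply: measurable_funM => //.
by apply: measurableT_comp => //; exact: measurable_cond_pmf_rv.
Qed.

Lemma mean_surprisal (dM : measure_display) (M : measurableType dM)
    (V : {mfun T >-> M}) (h : R) : cond_entropy b P Y V <= h%:E ->
  mean_le P (fun w => - (ln (cond_pmf P Y V (Y w) (V w)) / ln b))%R h.
Proof.
rewrite cond_entropyE// => Hh; apply: mean_le_ge0 => //.
- exact: measurable_surprisal.
- by move=> w; exact: surprisal_ge0.
Qed.

Variable F : {dffun forall j : 'I_n, S j} -> L -> R.
Hypotheses (F0 : forall x z, (0 <= F x z)%R)
           (mF : forall x, measurable_fun [set: L] (F x))
           (FE : {ae distribution P Z, forall z x,
              cond_pmf P (tuple_rv X) Z x z = (F x z * prod_pmf P X Z x z)%R}).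

Let f w := F (tuple_rv X w) (Z w).

Let measurable_f : measurable_fun [set: T] f.
Proof.
apply/measurable_EFinP.
apply: (@measurable_disintegration _ _ _ _ _ P _ (tuple_rv X) Z
  (fun x z => (F x z)%:E)) => [x z|x]; first by rewrite lee_fin.
exact/measurable_EFinP.
Qed.

(** From -ln f <= 1/f - 1 and the mean bound on 1/f, the negative part of log f is integrable; the
    assumed upper bound then controls the positive part. *)
Let mean_ln_density (e : R) : \int[P]_w (ln (f w) / ln b)%:E <= e%:E ->
  mean_le P (fun w => ln (f w) / ln b)%R e.
Proof.
apply: (mean_le_funeneg _ (v := fun w => ((ln b)^-1 * (f w)^-1)%R)
  (c' := ((ln b)^-1 * 1)%R)).
- by apply: measurable_funM => //; exact: measurableT_comp.
- apply: mean_leZ; first by rewrite invr_ge0 ltW.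
  exact: (mean_inv_density F0 mF FE).
- by move=> w; rewrite mulr_ge0 ?invr_ge0 ?F0// ltW.
- move=> w; rewrite -mulNr mulrC ler_pM2l ?invr_gt0//.
  have [->|f0] := eqVneq (f w) 0%R; first by rewrite ln0// oppr0 invr0.
  have fp : (0 < f w)%R by rewrite lt0r f0 F0.
  rewrite -lnV ?posrE// (le_trans (ln_le_subr1 _)) ?invr_gt0//.
  by rewrite gerBl.
Qed.

(** The observed tuple almost surely has positive conditional mass, and [f] is a factor of that
    mass. *)
Let density_gt0 : {ae P, forall w, (0 < f w)%R}.
Proof.
have := aeI (cond_pmf_gt0 P Z (tuple_rv X)) (ae_distribution FE).
apply: filterS => w [+ Fw]; rewrite Fw.
by rewrite lt0r mulf_eq0 negb_or -andbA => /andP[f0 _]; rewrite lt0r f0 F0.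
Qed.

Lemma cond_entropy_redundant_le (j1 j2 : 'I_n) (e h1 h2 : R) : j1 != j2 ->
  \int[P]_w (ln (f w) / ln b)%:E <= e%:E ->
  cond_entropy b P Y (X j1) <= h1%:E -> cond_entropy b P Y (X j2) <= h2%:E ->
  cond_entropy b P Y Z <= (e + (h1 + h2))%:E.
Proof.
move=> j12 /mean_ln_density me /mean_surprisal mh1 /mean_surprisal mh2.
pose t1 w := swap_ratio P X Z Y (X j1 w) (Y w) (Z w).
pose t2 w := swap_ratio P X Z Y (X j2 w) (Y w) (Z w).
pose t3 w := coupling_ratio P X Z Y F j1 j2 (Y w, tuple_rv X w) (Z w).
(* Three uses of ln t <= t - 1 produce the constant -3, which offsets the three means bounded by 1;
   the factor passes to base [b]. *)
have mt : mean_le P (fun w => (ln b)^-1 * (t1 w + (t2 w + (t3 w + (- 3)))))%R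
    ((ln b)^-1 * (1 + (1 + (1 + (- 3)))))%R.
  apply: mean_leZ; first by rewrite invr_ge0 ltW.
  apply: mean_leD; first exact: mean_swap_ratio.
  apply: mean_leD; first exact: mean_swap_ratio.
  apply: mean_leD; last exact: mean_le_cst.
  exact: mean_coupling_ratio.
have := mean_leD (mean_leD me (mean_leD mh1 mh2)) mt.
rewrite (_ : 1 + (1 + (1 + -3)) = 0 :> R)%R; last by ring.
rewrite mulr0 addr0 cond_entropyE//.
apply: mean_le_ae.
- exact: measurable_surprisal.
- by move=> w; exact: surprisal_ge0.
have pq1 := cond_pmf_gt0 P (X j1) Y.
have pq2 := cond_pmf_gt0 P (X j2) Y.
have pr1 := cond_pmf_gt0 P Z (X j1).
have pr2 := cond_pmf_gt0 P Z (X j2).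
have pa1 := cond_pmf_gt0 P Z (pair_rv (X j1) Y).
have pa2 := cond_pmf_gt0 P Z (pair_rv (X j2) Y).
have py := cond_pmf_gt0 P Z Y.
have ae_gt0 := aeI (aeI (aeI pq1 pq2) (aeI pr1 pr2))
  (aeI (aeI pa1 pa2) (aeI py density_gt0)).
apply: filterS ae_gt0 => w [[[q1 q2] [r1 r2]] [[a1 a2] [y0 f0]]].
rewrite /t1 /t2 /t3 /swap_ratio /coupling_ratio /= !ffunE -/(f w).
move: q1 q2 r1 r2 a1 a2 y0 f0; rewrite {1 2}/pair_rv.
set q1 := cond_pmf _ _ (X j1) _ _; set q2 := cond_pmf _ _ (X j2) _ _.
set r1 := cond_pmf _ (X j1) _ _ _; set r2 := cond_pmf _ (X j2) _ _ _.
set a1 := cond_pmf _ (pair_rv (X j1) Y) _ _ _.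
set a2 := cond_pmf _ (pair_rv (X j2) Y) _ _ _.
set y := cond_pmf _ Y Z _ _.
move: (f w) q1 q2 r1 r2 a1 a2 y => x q1 q2 r1 r2 a1 a2 y.
move=> q10 q20 r10 r20 a10 a20 y0 x0.
have T1 : (0 < q1 * r1 / a1)%R by rewrite divr_gt0 ?mulr_gt0.
have T2 : (0 < q2 * r2 / a2)%R by rewrite divr_gt0 ?mulr_gt0.
have T3 : (0 < a1 * a2 / (r1 * r2 * x * y))%R by rewrite divr_gt0 ?mulr_gt0.
have := ln_le_subr1 T1; have := ln_le_subr1 T2; have := ln_le_subr1 T3.
rewrite !ln_div ?lnM ?posrE ?mulr_gt0//.
set u3 := (_ / _)%R; set u2 := (_ / _)%R; set u1 := (_ / _)%R => l3 l2 l1.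
(* In the sum of the three logarithms all terms in [r1], [r2], [a1], [a2] cancel. *)
have lny : (- ln y <= ln x + (- ln q1 + - ln q2) +
    (u1 + (u2 + (u3 + (- 3)))))%R by lra.
have := ler_wpM2l (ltW (_ : 0 < (ln b)^-1))%R lny; rewrite invr_gt0 => /(_ lnb_gt0).
by rewrite !mulrDr !mulrN !(mulrC (ln b)^-1%R (ln _)).
Qed.

End redundancy_bound.

(** * Almost sure determination and vanishing conditional entropy *)

Section determined.
Context (R : realType) (b : R) (b_gt1 : 1 < b) (d dL : measure_display).
Context (T : measurableType d) (L : measurableType dL) (P : probability T R).
Context (S : alphabetType) (Y : {mfun T >-> discrete S}) (Z : {mfun T >-> L}).
Local Open Scope ereal_scope.

Let lnb_gt0 : (0 < ln b)%R. Proof. by rewrite ln_gt0. Qed.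

Lemma cond_entropy_ge0 : 0 <= cond_entropy b P Y Z.
Proof.
rewrite cond_entropyE//; apply: integral_ge0 => w _.
by rewrite lee_fin surprisal_ge0.
Qed.

(** A nonnegative surprisal has mean 0 exactly when it vanishes almost surely. *)
Lemma cond_entropy_eq0P : cond_entropy b P Y Z = 0 <->
  {ae P, forall w, cond_pmf P Y Z (Y w) (Z w) = 1%R}.
Proof.
rewrite cond_entropyE//; set u := fun w => _.
have mu : measurable_fun [set: T] u.
  by apply/measurable_EFinP; exact: measurable_surprisal.
have -> : \int[P]_w u w = \int[P]_w `|u w|.
  by apply: eq_integral => w _; rewrite gee0_abs// lee_fin surprisal_ge0.
rewrite ae_eq_integral_abs//; split => u0.
- have u0' : {ae P, forall w, u w = 0} by apply: filterS u0 => w; apply.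
  (* Positivity rules out mass 0, whose logarithm is 0 by convention. *)
  apply: filterS (aeI u0' (cond_pmf_gt0 P Z Y)) => w [/eqP + p0].
  rewrite /u eqe oppr_eq0 mulf_eq0 invr_eq0 (gt_eqF lnb_gt0) orbF ln_eq0//.
  by move/eqP.
- by apply: filterS u0 => w p1 _; rewrite /u p1 ln1 mul0r oppr0.
Qed.

(** The indicator of the fibre of [f] over [y] has the same integrals as the conditional mass of
    [y], so the two agree almost everywhere. *)
Lemma determined_by_cond_pmf1 : determined_by P Y Z ->
  {ae P, forall w, cond_pmf P Y Z (Y w) (Z w) = 1%R}.
Proof.
move=> [f [mf Yf]].
have mfy y : measurable (f @^-1` [set y]).
  by rewrite -[X in measurable X]setTI; exact: mf.
have pf : {ae distribution P Z, forall z y,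
    cond_pmf P Y Z y z = \1_(f @^-1` [set y]) z}.
  apply: (@ae_countable R S) => y.
  suff : ae_eq (distribution P Z) [set: L] (fun z => (\1_(f @^-1` [set y]) z)%:E)
      (fun z => (cond_pmf P Y Z y z)%:E).
    by apply: filterS => z /(_ I) [].
  apply: integral_ae_eq => //.
  - exact: integrable_indic.
  - by apply/measurable_EFinP; exact: measurable_cond_prob.
  - move=> B _ mB; rewrite integral_cond_prob// integral_indic//.
    rewrite -[LHS]/(P (Z @^-1` (f @^-1` [set y] `&` B))).
    have mYy := @measurable_preimage _ _ _ _ Y [set y] I.
    have mZB := @measurable_preimage _ _ _ _ Z _ mB.
    have mZf := @measurable_preimage _ _ _ _ Z _ (mfy y).
    rewrite -[in RHS]integral_indic// preimage_setI -integral_indic//.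
    apply: ae_eq_integral => //.
    + by apply/measurable_EFinP.
    + by apply/measurable_EFinP.
    + apply: filterS Yf => w Yw _; rewrite !indicE.
      by congr ((nat_of_bool _)%:R%:E); apply/idP/idP; rewrite !inE/= Yw.
apply: filterS (aeI Yf (ae_distribution pf)) => w [Yw ->].
by rewrite indicE mem_set.
Qed.

(** The function sends [z] to the only letter of conditional mass 1, or to [point] if there is no
    such unique letter. *)
Lemma cond_pmf1_determined_by :
  {ae P, forall w, cond_pmf P Y Z (Y w) (Z w) = 1%R} -> determined_by P Y Z.
Proof.
move=> Y1; pose E y := [set z | cond_pmf P Y Z y z = 1%R].
have mE y : measurable (E y).
  have := @measurable_cond_prob _ _ _ _ _ P _ Y Z [set y] measurableT.
  by move=> /(_ [set 1%R]); rewrite setTI; apply; exact: measurable_set1.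
(* Uniqueness is built into [G], so that the choice made by [xget] is forced and its fibres are
   measurable. *)
pose G y := E y `&` ~` \bigcup_(y' in [set y' | y' != y]) E y'.
have mG y : measurable (G y).
  apply: measurableI => //; apply: measurableC; rewrite bigcup_mkcond.
  apply: countable_bigcupT_measurable => [|y']; first exact: countableP.
  by case: ifP.
have Guniq z : is_subset1 [set y | G y z].
  move=> y y' [Ey _] [_ Gy']; apply/eqP/negPn/negP => yy'.
  by apply: Gy'; exists y.
exists (fun z => xget (point : S) [set y | G y z] : discrete S); split.
  apply: measurable_to_discrete => y.
  (* The fibre over the default letter also contains every [z] lying in no [G y']. *)
  have -> : (fun z => xget (point : S) [set y | G y z]) @^-1` [set y] =
      G y `|` (if y == point then ~` \bigcup_y' G y' else set0).
    apply/seteqP; split=> z /=.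
      case: xgetP => [y' -> Gy' <-|nG <-]; first by left.
      by right; rewrite eqxx => -[y' _]; exact: nG.
    move=> [Gy|]; first by apply: xget_subset1.
    by case: eqP => // -> nG; apply: xgetPN => y' Gy'; apply: nG; exists y'.
  apply: measurableU => //; case: ifP => // _; apply: measurableC.
  by apply: countable_bigcupT_measurable => //; exact: countableP.
apply: filterS (aeI Y1 (ae_distribution (esum_cond_pmf_le1 P Z Y))) => w.
move=> [Yw sum1]; apply/esym/xget_subset1 => //; split=> // -[y' /= y'Y Ey'].
move: sum1; apply/negP; rewrite -ltNge.
(* Two distinct letters of mass 1 would have total mass 2, above the bound 1. *)
apply: (@lt_le_trans _ _ (\sum_(y \in [set (Y w : S); y']) (cond_pmf P Y Z y (Z w))%:E)).
  rewrite fsbigU0/= ?fsbig_set1 ?Yw ?Ey'//.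
    by rewrite -EFinD lte_fin ltrDl.
  by move=> y [/= -> /esym/eqP]; rewrite (negPf y'Y).
by apply: esum_ge; exists [set (Y w : S); y'].
Qed.

End determined.

(** * Slices of the product law, its density and the divergence *)

Section product_law.
Context (R : realType) (d dL : measure_display).
Context (T : measurableType d) (L : measurableType dL) (P : probability T R).
Context (n : nat) (S : 'I_n -> alphabetType).
Context (X : forall j : 'I_n, {mfun T >-> discrete (S j)}).
Context (Z : {mfun T >-> L}).
Local Open Scope ereal_scope.

Local Notation PZ := (distribution P Z).
Local Notation tuples := {dffun forall j : 'I_n, S j}.
Local Notation law := (distribution P (joint_rv X Z)).
Local Notation prodlaw := (cond_product_law P X Z).

Lemma measurable_snd_fiber (x : tuples) :
  measurable [set p : L * discrete tuples | p.2 = x].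
Proof.
rewrite (_ : [set p | _] = snd @^-1` [set x : discrete tuples])//.
by rewrite -[X in measurable X]setTI; exact: measurable_snd.
Qed.

(** On the slice over [x] only the summand of index [x] survives. *)
Lemma cond_product_law_slice (x : tuples) (B : set L) :
  prodlaw (fst @^-1` B `&` [set p | p.2 = x]) =
  \int[PZ]_(z in B) (prod_pmf P X Z x z)%:E.
Proof.
rewrite /cond_product_law (_ : \esum_(y in _) _ =
    \esum_(y in [set x]) \int[PZ]_(z in B) (prod_pmf P X Z y z)%:E); last first.
  rewrite [RHS]esum_mkcond; apply: eq_esum => y _; case: ifPn => /=.
    rewrite inE /= => ->; congr integral.
    by apply/seteqP; split => z //= [].
  rewrite notin_setE /= => yx.
  rewrite [X in \int[_]_(_ in X) _](_ : _ = set0) ?integral_set0//.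
  by apply/seteqP; split => // z [] /= _ /yx.
by rewrite esum_set1// integral_ge0// => z _; rewrite lee_fin prod_pmf_ge0.
Qed.

Lemma integral_cond_product_law_slice (g : L * discrete tuples -> \bar R)
    (x : tuples) (B : set L) : measurable B ->
  (forall p, 0 <= g p) -> measurable_fun [set: _] g ->
  \int[prodlaw]_(p in fst @^-1` B `&` [set p | p.2 = x]) g p =
  \int[PZ]_(z in B) (g (z, x) * (prod_pmf P X Z x z)%:E).
Proof.
move=> mB g0 mg; have mx := measurable_snd_fiber x.
have mg' : measurable_fun [set: L] (fun z => g (z, x)).
  exact: (measurableT_comp mg (@pair2_measurable _ _ L (discrete tuples) x)).
(* Restricted to one slice the product law is finite, because [prod_pmf] is at most 1; its image
   under [fst] then has density [prod_pmf P X Z x]. *)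
pose m := mrestr prodlaw mx.
have mfin : fin_num_fun m.
  move=> A mA; rewrite ge0_fin_numE//.
  apply: (@le_lt_trans _ _ (prodlaw (fst @^-1` [set: L] `&` [set p | p.2 = x]))).
    by apply: (le_measure m); rewrite ?inE// preimage_setT.
  rewrite cond_product_law_slice; apply: (@le_lt_trans _ _ (\int[PZ]_z cst 1 z)).
    apply: ge0_le_integral => //.
    - by move=> z _; rewrite lee_fin prod_pmf_ge0.
    - by apply/measurable_EFinP; exact: measurable_prod_pmf.
    - by move=> z _; rewrite lee_fin prod_pmf_le1.
  rewrite integral_cst// mul1e.
  exact: (le_lt_trans (probability_le1 _ measurableT) (ltry _)).
pose fs := @fst L (discrete tuples).
have mfs : isMeasurableFun _ _ _ _ fs by constructor; exact: measurable_fst.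
pose fsm : {mfun (L * discrete tuples)%type >-> L} := HB.pack fs mfs.
rewrite -(@integral_density _ _ _ PZ (pushforward m fsm))//.
- rewrite ge0_integral_pushforward//.
  rewrite (@integral_density _ _ _ prodlaw m (\1_[set p | p.2 = x]))//.
  + rewrite integral_mkcondr; apply: eq_integral => p _.
    rewrite patchE /= indicE; case: ifPn => [|_]; last by rewrite mule0.
    by rewrite inE /= mule1 => <-; rewrite -surjective_pairing.
  + by move=> A mA; rewrite integral_indic// setIC.
  + by rewrite -[X in measurable X]setTI; exact: measurable_fst.
  + by move=> p; exact: g0.
  + by apply: measurableT_comp => //; exact: measurable_fst.
  + exact: measurable_funTS.
- move=> A mA; apply: mfin.
  by rewrite -[X in measurable X]setTI; exact: measurable_fst.
- by move=> z; exact: prod_pmf_ge0.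
- exact: measurable_prod_pmf.
- by move=> A mA; rewrite -cond_product_law_slice.
Qed.

Hypothesis law_dominated : law `<< prodlaw.

(** Real-valued and curried, tuple first, to serve as [F] in the entropy bound. *)
Definition product_density (x : tuples) (z : L) : R :=
  fine (Radon_Nikodym_SigmaFinite.f law prodlaw (z, x)).

Let mRN : measurable_fun [set: _] (Radon_Nikodym_SigmaFinite.f law prodlaw).
Proof.
exact: measurable_int (Radon_Nikodym_SigmaFinite.f_integrable law_dominated).
Qed.

Lemma product_density_ge0 x z : (0 <= product_density x z)%R.
Proof. by rewrite fine_ge0// Radon_Nikodym_SigmaFinite.f_ge0. Qed.

Lemma measurable_product_density x : measurable_fun [set: L] (product_density x).
Proof.
apply: measurableT_comp => //.
exact: (measurableT_comp mRN (@pair2_measurable _ _ L (discrete tuples) x)).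
Qed.

(** For each [x], both sides integrate over [B] to the joint probability of the slice of [B] over
    [x]. *)
Lemma cond_pmf_tupleE : {ae PZ, forall z x, cond_pmf P (tuple_rv X) Z x z =
  (product_density x z * prod_pmf P X Z x z)%R}.
Proof.
apply: (@ae_countable R tuples) => x.
suff : ae_eq PZ [set: L] (fun z => (cond_pmf P (tuple_rv X) Z x z)%:E)
    (fun z => (product_density x z * prod_pmf P X Z x z)%:E).
  by apply: filterS => z /(_ I) [].
apply: integral_ae_eq => //.
- exact: integrable_cond_prob.
- apply/measurable_EFinP; apply: measurable_funM.
    exact: measurable_product_density.
  exact: measurable_prod_pmf.
- move=> B _ mB; rewrite integral_cond_prob//.
  under eq_integral.
    move=> z _; rewrite EFinM /product_density fineK; last first.
      exact: Radon_Nikodym_SigmaFinite.f_fin_num.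
    over.
  rewrite -(@integral_cond_product_law_slice
    (Radon_Nikodym_SigmaFinite.f law prodlaw))//; last first.
    by move=> p; exact: Radon_Nikodym_SigmaFinite.f_ge0.
  rewrite -Radon_Nikodym_SigmaFinite.f_integral//.
    by rewrite setIC; congr (P _).
  apply: measurableI; last exact: measurable_snd_fiber.
  by rewrite -[X in measurable X]setTI; exact: measurable_fst.
Qed.

(** The logarithm has no fixed sign, so the change of variables is done on positive and negative
    parts separately. *)
Lemma KL_product_densityE (b : R) : KL b law prodlaw =
  \int[P]_w (ln (product_density (tuple_rv X w) (Z w)) / ln b)%:E.
Proof.
rewrite /KL asboolT//.
pose u p := (ln (fine (Radon_Nikodym_SigmaFinite.f law prodlaw p)) / ln b)%:E.
rewrite -[LHS]/(\int[law]_p u p); have mu : measurable_fun [set: _] u.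
  apply/measurable_EFinP; apply: measurable_funM => //.
  apply: measurableT_comp; first exact: measurable_ln.
  exact: measurableT_comp.
rewrite integralE [RHS]integralE.
rewrite !ge0_integral_distribution//; last 2 first.
- exact: measurable_funeneg.
- exact: measurable_funepos.
by congr (_ - _); apply: eq_integral => w _; rewrite /= ?funeposE ?funenegE.
Qed.

End product_law.

(** * Conditional independence, and both forms of the theorem *)

Lemma cond_independent_pmf (R : realType) (d dL : measure_display)
    (T : measurableType d) (L : measurableType dL) (P : probability T R)
    (n : nat) (S : 'I_n -> alphabetType)
    (X : forall j : 'I_n, {mfun T >-> discrete (S j)}) (Z : {mfun T >-> L}) :
  cond_independent P X Z ->
  {ae distribution P Z, forall z x,
    cond_pmf P (tuple_rv X) Z x z = prod_pmf P X Z x z}.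
Proof.
move=> XZ; apply: (@ae_countable R {dffun forall j, S j}) => x.
(* The product of the singletons [x j] contains the tuple [x] only. *)
apply: filterS (XZ (fun j => [set x j])) => z XZz.
rewrite /prod_pmf /cond_pmf -XZz; congr (cond_prob _ _ _ _ _).
apply/seteqP; split=> [y -> //|y xy]; apply/ffunP => j; exact: xy.
Qed.

Theorem theorem1 (R : realType) (b : R) (hb : 1 < b)
    (d : measure_display) (T : measurableType d) (P : probability T R)
    (dL : measure_display) (L : measurableType dL) (hL : standard_borel R L)
    (n : nat) (hn : (2 <= n)%N)
    (S : 'I_n -> alphabetType) (S' : alphabetType)
    (X : forall j : 'I_n, {RV P >-> discrete (S j)})
    (Lam : {RV P >-> L}) (Lam' : {RV P >-> discrete S'}) :
  (cond_independent P X Lam ->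
     ((forall j : 'I_n, determined_by P Lam' (X j)) ->
        determined_by P Lam' Lam) /\
     ((forall j : 'I_n, cond_entropy b P Lam' (X j) = 0%E) ->
        cond_entropy b P Lam' Lam = 0%E)) /\
  (forall e_med e_red : R, 0 <= e_med -> 0 <= e_red ->
     (KL b (distribution P (joint_rv X Lam)) (cond_product_law P X Lam)
        <= e_med%:E)%E ->
     (forall j : 'I_n, (cond_entropy b P Lam' (X j) <= e_red%:E)%E) ->
     (cond_entropy b P Lam' Lam <= (e_med + 2 * e_red)%:E)%E).
Proof.
have [j1 [j2 j12]] : exists j1 j2 : 'I_n, j1 != j2.
  (* The indices are 0 and 1, available because [n] is at least 2. *)
  by exists (Ordinal (ltnW hn)), (Ordinal hn).
split=> [XZ|e_med e_red _ _ KLe He].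
  have H0 : (forall j, cond_entropy b P Lam' (X j) = 0%E) ->
      cond_entropy b P Lam' Lam = 0%E.
    move=> HX; apply/eqP; rewrite eq_le cond_entropy_ge0// andbT.
    rewrite -[leRHS]/((0 : R)%:E) -(addr0 0) -[X in (_ + X)](addr0 0).
    (* Under conditional independence the density is constantly 1 and its logarithm 0, so all three
       terms of the bound vanish. *)
    apply: (cond_entropy_redundant_le hb (F := fun _ _ => 1) _ _ _ j12).
    - by [].
    - by move=> x; exact: measurable_cst.
    - by apply: filterS (cond_independent_pmf XZ) => z XZz x; rewrite mul1r; exact: XZz.
    - by rewrite ln1 mul0r integral0.
    - by rewrite HX.
    - by rewrite HX.
  split=> // detX; apply: cond_pmf1_determined_by.
  apply/(cond_entropy_eq0P hb)/H0 => j; apply/(cond_entropy_eq0P hb).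
  exact: determined_by_cond_pmf1.
(* A finite divergence forces absolute continuity, since [KL] is infinite otherwise. *)
have dom : distribution P (joint_rv X Lam) `<< cond_product_law P X Lam.
  by move: KLe; rewrite /KL; case: asboolP => //; rewrite leye_eq.
rewrite mulr_natl mulr2n.
apply: (cond_entropy_redundant_le hb (F := product_density P X Lam) _ _ _ j12).
- exact: product_density_ge0.
- exact: measurable_product_density.
- exact: cond_pmf_tupleE.
- by rewrite -KL_product_densityE.
- exact: He.
- exact: He.
Qed.
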